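(* For $n=3,4,5$, there do not exist rational $5$-designs with $n$ points for the Hermite measure $e^{-t^2}dt/\sqrt{\pi}$ on $(-\infty,\infty)$.
   Context: An $m$-design with $n$ points for a probability measure $w(t)dt$ on an interval $I$ is a set of $n$ pairwise distinct points $x_1,\dots,x_n\in I$ with $\frac1n\sum_i f(x_i)=\int_I f(t)w(t)dt$ for every real polynomial $f$ of degree at most $m$; it is rational if all $x_i\in\mathbb{Q}$. *)

(* Defs.v *)
From mathcomp Require Import all_boot all_order all_algebra.
From mathcomp Require Import all_classical all_reals all_analysis.

Set Implicit Arguments.
Unset Strict Implicit.
Unset Printing Implicit Defensive.

Import Order.TTheory GRing.Theory Num.Theory.
Import numFieldNormedType.Exports.

Local Open Scope classical_set_scope.
Local Open Scope ring_scope.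

(* The integral is extended-real valued, so the equation also forces the
   integral of p * w over I to be finite. *)
Definition is_design (R : realType) (I : interval R) (w : R -> R)
    (m n : nat) (x : 'I_n -> R) : Prop :=
  [/\ injective x,
      forall i, x i \in I &
      forall p : {poly R}, (size p <= m.+1)%N ->
        (n%:R^-1 * \sum_(i < n) p.[x i])%:E =
        (\int[lebesgue_measure]_(t in [set` I]) (p.[t] * w t)%:E)%E].

Definition is_rational_design (R : realType) (I : interval R) (w : R -> R)
    (m n : nat) (x : 'I_n -> R) : Prop :=
  is_design I w m x /\ forall i, exists q : rat, x i = ratr q.

Definition hermite_weight (R : realType) (t : R) : R :=
  expR (- t ^+ 2) / Num.sqrt pi.

(* Main.v *)
Require Import Defs.
From mathcomp Require Import all_boot all_order all_algebra.
From mathcomp Require Import all_classical all_reals all_analysis.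
From mathcomp Require Import measurable_realfun ring lra.

(** A design inherits from the Hermite weight the identity
    [sum_i (p' - 2 X p)(x_i) = 0], since [(p' - 2 X p) exp(-t^2)] is the
    derivative of [p exp(-t^2)]; it fixes the power sums
    [P1 = P3 = P5 = 0], [P2 = n/2], [P4 = 3n/4]. No real points have these power
    sums: for [n = 3], [P1 = 0] forces [2 P4 = P2^2]; for [n = 4],
    [P1 = P3 = 0] forces the points to be [a, -a, b, -b], whence
    [2 P4 <= P2^2]; for [n = 5], [P1 = P3 = P5 = 0] forces one point to be [0],
    and the other four satisfy the same inequality. *)

Set Implicit Arguments.
Unset Strict Implicit.
Unset Printing Implicit Defensive.

Import Order.TTheory GRing.Theory Num.Theory.
Import numFieldNormedType.Exports.

Local Open Scope classical_set_scope.
Local Open Scope ring_scope.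

(** * Integration of derivatives over the real line *)

(** The integral is that of [f^+] minus that of [f^-]; a finite difference forces both to be finite,
    hence also their sum, the integral of [|f|]. *)
Lemma fin_num_integral_integrable (d : measure_display) (T : measurableType d)
    (R : realType) (mu : {measure set T -> \bar R}) (D : set T)
    (f : T -> \bar R) :
  measurable D -> measurable_fun D f ->
  (\int[mu]_(x in D) f x)%E \is a fin_num -> mu.-integrable D f.
Proof.
move=> mD mf; rewrite integralE fin_numB => /andP[fp fn].
apply/integrableP; split => //.
rewrite -[X in (integral _ _ X < _)%E]/(abse \o f) fune_abse.
rewrite ge0_integralD//.
- by rewrite lte_add_pinfty ?ltey_eq ?fp ?fn.
- exact: measurable_funepos.
- exact: measurable_funeneg.
Qed.

(** Truncate [f] to [[- c n, c n]], apply the compact case there, and pass to the limit by dominated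
    convergence with bound [|f|]. *)
Lemma integrable_continuous_FTC2T (R : realType) (f F : R -> R) (a b : R) :
  (@lebesgue_measure R).-integrable setT (EFin \o f) -> continuous f ->
  (forall x : R, is_derive x (1 : R) F (f x)) ->
  F x @[x --> -oo] --> a -> F x @[x --> +oo] --> b ->
  (\int[lebesgue_measure]_x (f x)%:E = (b - a)%:E)%E.
Proof.
move=> intf cf dF Fa Fb.
have cF : continuous F.
  move=> x; apply: differentiable_continuous; apply/derivable1_diffP.
  by case: (dF x).
(* The shift to [n.+1] keeps [- c n < c n] strict even at [n = 0]. *)
pose c n : R := n.+1%:R.
pose g n : R -> \bar R := (EFin \o f) \_ `[- c n, c n].
have mf := measurable_int _ intf.
have cy : c n @[n --> \oo] --> +oo by rewrite cvg_shiftS; exact: cvgr_idn.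
have gf (x : R) : g n x @[n --> \oo] --> (f x)%:E.
  apply: cvg_near_cst; near=> n.
  rewrite /g patchE ifT// inE/= in_itv/= -ler_norml.
  near: n; move/cvgryPge : cy; exact.
have gle n (x : R) : (`|g n x| <= `|(f x)%:E|)%E.
  by rewrite /g patchE; case: ifPn => // _; rewrite abse0.
have mg n : measurable_fun [set: measurableTypeR R] (g n).
  apply/(measurable_restrictT _ _).1 => //.
  exact: measurable_funS mf.
have aegf : {ae lebesgue_measure, forall x : R, setT x ->
    g n x @[n --> \oo] --> (EFin \o f) x}.
  by apply: aeW => x _; exact: gf.
have aegle : {ae lebesgue_measure, forall x : R, forall n, setT x ->
    (`|g n x| <= (abse \o (EFin \o f)) x)%E}.
  by apply: aeW => x n _; exact: gle.
have [_ _ cvg_g] := dominated_convergence measurableT mg mf aegf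
  (integrable_abse intf) aegle.
have cvgF : (F (c n) - F (- c n))%:E @[n --> \oo] --> (b - a)%:E.
  apply/cvg_EFin; first exact: nearW.
  apply: cvgB.
  - exact: (cvg_comp c F cy Fb).
  - apply: (cvg_comp c (F \o -%R) cy); exact/cvgNy_compNP.
apply: (cvg_unique _ cvg_g) => //.
apply: cvg_trans cvgF; apply: near_eq_cvg; apply: nearW => n /=.
rewrite EFinB /g -integral_mkcond -(@continuous_FTC2 R f)//.
- by rewrite /c gtrN.
- exact: continuous_subspaceT.
- split=> [x _||].
  + by case: (dF x).
  + by apply: cvg_at_right_filter; exact: cF.
  + by apply: cvg_at_left_filter; exact: cF.
- by move=> x _; rewrite derive1E; case: (dF x).
Unshelve. all: by end_near. Qed.

(** * Gaussian decay and the vanishing integral *)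

Lemma cvgy_horner_gauss (R : realType) (p : {poly R}) :
  p.[x] * gauss_fun x @[x --> +oo] --> (0 : R).
Proof.
have monom k : x ^+ k * gauss_fun x @[x --> +oo] --> (0 : R).
  apply: (@squeeze_cvgr _ _ _ _ (fun _ => 0) (fun x => k.+1`!%:R * x^-1)).
  - near=> x.
    have x1 : 1 <= x by near: x; apply: nbhs_pinfty_ge; exact: num_real.
    have x0 : 0 < x by apply: lt_le_trans x1.
    rewrite mulr_ge0 ?exprn_ge0 ?gauss_fun_ge0 ?(ltW x0)//=.
    rewrite /gauss_fun expRN ler_pdivrMr ?expR_gt0//.
    (* One term of the exponential series at [x ^+ 2] gives [exp(x^2) >= x^(2k+2) / (k+1)! >=
       x^(k+1) / (k+1)!] for [x >= 1]. *)
    have := expR_ge1Dxn k (sqr_ge0 x) => /(le_trans _) H.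
    have {}H : x ^+ k.+1 / k.+1`!%:R <= expR (x ^+ 2).
      apply: H; rewrite -[leLHS]add0r lerD//.
      rewrite ler_pM2r ?invr_gt0 ?ltr0n ?fact_gt0// -exprM mulnC muln2 -addnn.
      by rewrite exprD ler_peMr ?exprn_ge0 ?exprn_ege1 ?(ltW x0).
    move: H; rewrite ler_pdivrMr ?ltr0n ?fact_gt0// exprS => H.
    by rewrite mulrAC ler_pdivlMr// mulrC [leRHS]mulrC.
  - exact: cvg_cst.
  - rewrite -[X in _ --> X](mulr0 k.+1`!%:R); apply: cvgMl_tmp.
    apply/gtr0_cvgV0; last exact: cvg_id.
    exact: nbhs_pinfty_gt.
(* The extra factor [x ^+ k] makes the induction go through: passing from [p] to [p * 'X + c] raises
   [k] by one. *)
suff H k : x ^+ k * p.[x] * gauss_fun x @[x --> +oo] --> (0 : R).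
  by have := H 0; under eq_fun do rewrite expr0 mul1r.
elim/poly_ind: p k => [|p c IH] k.
  by under eq_fun do rewrite horner0 mulr0 mul0r; exact: cvg_cst.
have -> : (fun x => x ^+ k * (p * 'X + c%:P).[x] * gauss_fun x) =
    (fun x => x ^+ k.+1 * p.[x] * gauss_fun x + c * (x ^+ k * gauss_fun x)).
  apply/funext => x; rewrite hornerD hornerMX hornerC exprS; ring.
rewrite -[X in _ --> X](addr0 0) -[X in _ --> _ + X](mulr0 c).
by apply: cvgD; [exact: IH|exact: cvgMl_tmp].
Unshelve. all: by end_near. Qed.

Lemma cvgNy_horner_gauss (R : realType) (p : {poly R}) :
  p.[x] * gauss_fun x @[x --> -oo] --> (0 : R).
Proof.
apply/cvgNy_compNP.
have -> : (fun x => p.[x] * gauss_fun x) \o -%R =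
    (fun x => (p \Po - 'X).[x] * gauss_fun x).
  by apply/funext => x /=; rewrite horner_comp !hornerE /gauss_fun sqrrN.
exact: cvgy_horner_gauss.
Qed.

Lemma is_derive_horner_gauss (R : realType) (p : {poly R}) (x : R) :
  is_derive x (1 : R) (fun t => p.[t] * gauss_fun t)
    ((p^`() - 2 *: (p * 'X)).[x] * gauss_fun x).
Proof.
have dg : is_derive x (1 : R) gauss_fun (gauss_fun x * (- (2 * x))).
  apply: (@is_derive1_comp R expR (fun t => - t ^+ 2)).
  have -> : (fun t : R => - t ^+ 2) = horner (- 'X^2).
    by apply/funext => t; rewrite !hornerE.
  have := is_derive_poly (- 'X^2) x.
  by rewrite derivN derivXn/= hornerN hornerMn hornerX mulr_natl.
apply: is_derive_eq.
by rewrite /GRing.scale/= !hornerE/=; ring.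
Qed.

Lemma hermite_weightE (R : realType) (t : R) :
  hermite_weight t = (Num.sqrt pi)^-1 * gauss_fun t.
Proof. by rewrite mulrC. Qed.

(** The integrand is the derivative of a multiple of [p.[t] * gauss_fun t], which tends to 0 at both
    ends. The value [r] being real supplies the integrability. *)
Lemma integral_hermite_adjoint (R : realType) (p : {poly R}) (r : R) :
  (\int[lebesgue_measure]_(t in [set` `]-oo, +oo[])
     ((p^`() - 2 *: (p * 'X)).[t] * hermite_weight t)%:E)%E = r%:E ->
  r = 0.
Proof.
rewrite set_itvNyy.
set q := p^`() - _; set s := (Num.sqrt pi)^-1 : R.
have -> : (fun t => (q.[t] * hermite_weight t)%:E) =
    EFin \o (fun t => (s *: q).[t] * gauss_fun t).
  apply/funext => t /=; rewrite hermite_weightE hornerZ; congr EFin.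
  by rewrite mulrCA mulrA.
have cf : continuous (fun t => (s *: q).[t] * gauss_fun t).
  move=> t; apply: continuousM; first exact: continuous_horner.
  exact: continuous_gauss_fun.
move=> intr.
have intf : lebesgue_measure.-integrable setT
    (EFin \o (fun t => (s *: q).[t] * gauss_fun t)).
  apply: fin_num_integral_integrable => //; last by rewrite intr.
  by apply/measurable_EFinP; exact: continuous_measurable_fun.
have df (t : R) : is_derive t (1 : R) (fun t => (s *: p).[t] * gauss_fun t)
    ((s *: q).[t] * gauss_fun t).
  have <- : (s *: p)^`() - 2 *: ((s *: p) * 'X) = s *: q.
    by rewrite derivZ -scalerAl scalerBr !scalerA [2 * s]mulrC.
  exact: is_derive_horner_gauss.
move: intr; rewrite (integrable_continuous_FTC2T intf cf df
  (@cvgNy_horner_gauss _ _) (@cvgy_horner_gauss _ _)).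
by rewrite subrr => -[].
Qed.

(** * Power sums of a design *)

Lemma hermite_design_adjoint (R : realType) (n : nat) (x : 'I_n -> R)
    (n_gt0 : (0 < n)%N) (dx : is_design `]-oo, +oo[ (@hermite_weight R) 5%N x)
    (p : {poly R}) :
  (size p <= 5)%N ->
  \sum_(i < n) (p^`() - 2 *: (p * 'X)).[x i] = 0.
Proof.
move=> sp; case: dx => _ _ /(_ (p^`() - 2 *: (p * 'X))) H.
(* Multiplication by ['X] raises the degree by one, so [p] of degree at most 4 stays within the
   strength 5 of the design. *)
have sq : (size (p^`() - 2 *: (p * 'X))%R <= 6)%N.
  rewrite (leq_trans (size_polyD _ _))// geq_max size_polyN.
  apply/andP; split.
    have [->|p0] := eqVneq p 0; first by rewrite deriv0 size_poly0.
    exact: leq_trans (ltnW (lt_size_deriv p0)) (leqW sp).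
  rewrite (leq_trans (size_scale_leq _ _))// (leq_trans (size_polyMleq _ _))//.
  by rewrite size_polyX addn2.
have /eqP := integral_hermite_adjoint (esym (H sq)).
by rewrite mulf_eq0 invr_eq0 pnatr_eq0 gtn_eqF//= => /eqP.
Qed.

Definition power_sum (R : realType) (n : nat) (x : 'I_n -> R) (k : nat) : R :=
  \sum_(i < n) x i ^+ k.

(** Take [p = 'X^(k.+1)] in the adjoint identity; its degree is at most 4 exactly when [k < 4]. *)
Lemma power_sum_rec (R : realType) (n : nat) (x : 'I_n -> R)
    (n_gt0 : (0 < n)%N) (dx : is_design `]-oo, +oo[ (@hermite_weight R) 5%N x)
    (k : nat) :
  (k < 4)%N -> power_sum x k.+2 = k.+1%:R / 2 * power_sum x k.
Proof.
move=> k4; have := @hermite_design_adjoint _ _ _ n_gt0 dx ('X^(k.+1)).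
rewrite size_polyXn => /(_ k4); rewrite derivXn -exprSr /=.
under eq_bigr do rewrite hornerD hornerN hornerZ hornerMn !hornerXn -mulr_natl.
rewrite sumrB -!mulr_sumr -/(power_sum x _) -/(power_sum x k) => /eqP.
by rewrite subr_eq0 => /eqP H; rewrite mulrAC H mulrC mulKf.
Qed.

(** The choice [p = 1] gives the starting value for the odd power sums. *)
Lemma power_sum1 (R : realType) (n : nat) (x : 'I_n -> R)
    (n_gt0 : (0 < n)%N) (dx : is_design `]-oo, +oo[ (@hermite_weight R) 5%N x) :
  power_sum x 1 = 0.
Proof.
have := @hermite_design_adjoint _ _ _ n_gt0 dx 1; rewrite size_poly1 => /(_ isT).
rewrite -[1]/(1%:P) derivC mul1r sub0r.
under eq_bigr do rewrite hornerN hornerZ hornerX.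
rewrite sumrN -mulr_sumr => /eqP; rewrite oppr_eq0 mulf_eq0 pnatr_eq0/= => /eqP <-.
by apply: eq_bigr => i _; rewrite expr1.
Qed.

(** * Algebraic constraints on power sums *)

(** When the sum vanishes, the cubes add up to [-3 (a + b) (b + c) (c + a)]. So the numbers split
    into two opposite pairs [u, -u, v, -v], and the two sides differ by [8 (u v)^2]. *)
Lemma power_sum4_le (F : realFieldType) (a b c d : F) :
  a + b + c + d = 0 -> a ^+ 3 + b ^+ 3 + c ^+ 3 + d ^+ 3 = 0 ->
  2 * (a ^+ 4 + b ^+ 4 + c ^+ 4 + d ^+ 4) <=
    (a ^+ 2 + b ^+ 2 + c ^+ 2 + d ^+ 2) ^+ 2.
Proof.
move=> s1 s3; have dE : d = - (a + b + c) by lra.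
have : (a + b) * ((b + c) * (c + a)) = 0 by rewrite dE in s3; lra.
rewrite -subr_ge0; subst d => /eqP; rewrite !mulf_eq0 !addr_eq0.
move=> /orP[/eqP ->|/orP[/eqP ->|/eqP ->]].
- rewrite [leRHS](_ : _ = 8 * (b * c) ^+ 2); last by ring.
  by rewrite mulr_ge0 ?sqr_ge0.
- rewrite [leRHS](_ : _ = 8 * (a * c) ^+ 2); last by ring.
  by rewrite mulr_ge0 ?sqr_ge0.
- rewrite [leRHS](_ : _ = 8 * (a * b) ^+ 2); last by ring.
  by rewrite mulr_ge0 ?sqr_ge0.
Qed.

Lemma odd_power_sums_prod_eq0 (F : realFieldType) (a b c d e : F) :
  a + b + c + d + e = 0 ->
  a ^+ 3 + b ^+ 3 + c ^+ 3 + d ^+ 3 + e ^+ 3 = 0 ->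
  a ^+ 5 + b ^+ 5 + c ^+ 5 + d ^+ 5 + e ^+ 5 = 0 ->
  a * (b * (c * (d * e))) = 0.
Proof.
move=> s1 s3 s5; have eE : e = - (a + b + c + d) by lra.
(* By Newton's identities, [5 e5 = P5 - 5/6 P2 P3] when [P1 = 0]. *)
apply: (@mulfI _ 5) => //; rewrite mulr0 -[RHS](subrr 0) -{1}s5.
set P2 := a ^+ 2 + b ^+ 2 + c ^+ 2 + d ^+ 2 + e ^+ 2.
rewrite -[X in _ - X](mulr0 (5 / 6 * P2)) -s3 /P2.
by rewrite eE; field.
Qed.

Theorem theorem2p22 (R : realType) (n : nat)
    (hn : n = 3%N \/ n = 4%N \/ n = 5%N) :
  ~ exists x : 'I_n -> R,
      is_rational_design `]-oo, +oo[ (@hermite_weight R) 5%N x.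
Proof.
case=> x [dx _]; have n0 : (0 < n)%N by case: hn => [|[|]] ->.
have p1 := power_sum1 n0 dx.
have p0 : power_sum x 0 = n%:R.
  rewrite /power_sum; under eq_bigr do rewrite expr0.
  by rewrite sumr_const card_ord.
have p2 : power_sum x 2 = n%:R / 2 by rewrite (power_sum_rec n0 dx)// p0; field.
have p3 : power_sum x 3 = 0 by rewrite (power_sum_rec n0 dx)// p1 mulr0.
have p4 : power_sum x 4 = 3 / 4 * n%:R by rewrite (power_sum_rec n0 dx)// p2; field.
have p5 : power_sum x 5 = 0 by rewrite (power_sum_rec n0 dx)// p3 mulr0.
(* Here [2 P4 = 3n/2] and [P2^2 = n^2/4], so [2 P4 > P2^2] as long as [n < 6]. *)
move: p1 p2 p3 p4 p5; rewrite /power_sum => {p0 n0}.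
case: hn x dx => [|[|]] -> x _; rewrite !big_ord_recr !big_ord0/= !add0r !expr1.
- move: (x _) (x _) (x _) => c b a s1 s2 _ s4 _.
  have cE : c = - (a + b) by lra.
  (* With [P2 = 3/2] this identity would give [P4 = 9/8], against [P4 = 9/4]. *)
  suff : a ^+ 4 + b ^+ 4 + c ^+ 4 = (a ^+ 2 + b ^+ 2 + c ^+ 2) ^+ 2 / 2.
    by rewrite s2 s4; lra.
  by rewrite cE; field.
- move: (x _) (x _) (x _) (x _) => d c b a s1 s2 s3 s4 _.
  (* The inequality would read [6 <= 4]. *)
  by have := power_sum4_le s1 s3; rewrite s2 s4; lra.
- move: (x _) (x _) (x _) (x _) (x _) => e d c b a s1 s2 s3 s4 s5.
  have /eqP := odd_power_sums_prod_eq0 s1 s3 s5.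
  (* The four points left after removing a zero keep the power sums of all five; the inequality
     would read [15/2 <= 25/4]. *)
  have no4 (y z t u : R) : y + z + t + u = 0 ->
      y ^+ 3 + z ^+ 3 + t ^+ 3 + u ^+ 3 = 0 ->
      y ^+ 2 + z ^+ 2 + t ^+ 2 + u ^+ 2 = 5 / 2 ->
      y ^+ 4 + z ^+ 4 + t ^+ 4 + u ^+ 4 = 15 / 4 -> False.
    by move=> q1 q3 q2 q4; have := power_sum4_le q1 q3; rewrite q2 q4; lra.
  rewrite !mulf_eq0 => /orP[|/orP[|/orP[|/orP[|]]]] /eqP z0;
    move: s1 s2 s3 s4; rewrite z0 !expr0n/= => s1 s2 s3 s4.
  + by apply: (no4 b c d e); lra.
  + by apply: (no4 a c d e); lra.
  + by apply: (no4 a b d e); lra.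
  + by apply: (no4 a b c e); lra.
  + by apply: (no4 a b c d); lra.
Qed.
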